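(* Let $(X,\tau,E)$ be a soft topological space over $X$ and let $(F,E)$ be a soft set over $X$. Then $$\mathrm{bd}^s(\mathrm{bd}^s(\mathrm{bd}^s(F,E)))=\mathrm{bd}^s(\mathrm{bd}^s(F,E)).$$
   Context: Let $X$ be a universe and $E$ a nonempty set of parameters. A soft set $(F,E)$ over $X$ is a mapping $F:E\to P(X)$, where $P(X)$ is the power set of $X$. Inclusion $(F,E)\subseteq(G,E)$, union and intersection of soft sets are taken parameterwise (e.g. $(F,E)\subseteq(G,E)$ iff $F(e)\subseteq G(e)$ for all $e\in E$). $\Phi$ is the soft set with value $\emptyset$ at every parameter and $\widetilde X$ the soft set with value $X$ at every parameter. The relative complement is $(F,E)'=(F',E)$, $F'(e)=X\setminus F(e)$. A soft topology on $X$ is a collection $\tau$ of soft sets $(F,E)$ over $X$ containing $\Phi$ and $\widetilde X$, closed under arbitrary unions and under intersections of two members; $(X,\tau,E)$ is then a soft topological space over $X$. Members of $\tau$ are soft open; $(F,E)$ is soft closed if $(F,E)'\in\tau$. The soft closure $\overline{(F,E)}$ is the intersection of all soft closed sets containing $(F,E)$. A soft set $(F,E)$ is soft semi-open if there is a soft open set $(G,E)$ with $(G,E)\subseteq(F,E)\subseteq\overline{(G,E)}$. The soft semi-interior $\mathrm{int}^s(F,E)$ is the union of all soft semi-open sets contained in $(F,E)$; the soft semi-exterior is $\mathrm{ext}^s(F,E)=\mathrm{int}^s((F,E)')$; the soft semi-boundary is $\mathrm{bd}^s(F,E)=(\mathrm{int}^s(F,E)\cup \mathrm{ext}^s(F,E))'$.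 *)

(* Defs.v *)
From mathcomp Require Import all_boot.
From mathcomp Require Import boolp classical_sets.

Set Implicit Arguments.
Unset Strict Implicit.
Unset Printing Implicit Defensive.

Local Open Scope classical_set_scope.

(** The parameter set is the whole type [E]; its nonemptiness is a hypothesis
    of the statements, as [inhabited E]. *)
Definition soft_set (X E : Type) := E -> set X.

Section SoftSets.
Context {X E : Type}.
Implicit Types (F G : soft_set X E) (S : set (soft_set X E)).

Definition soft_null : soft_set X E := fun _ => set0.
Definition soft_absolute : soft_set X E := fun _ => setT.

Definition soft_subset F G : Prop := forall e, F e `<=` G e.
Definition soft_union F G : soft_set X E := fun e => F e `|` G e.
Definition soft_inter F G : soft_set X E := fun e => F e `&` G e.
Definition soft_compl F : soft_set X E := fun e => ~` F e.

Definition soft_bigunion S : soft_set X E := fun e => \bigcup_(F in S) F e.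
Definition soft_biginter S : soft_set X E := fun e => \bigcap_(F in S) F e.

End SoftSets.

Record soft_topology (X E : Type) (tau : set (soft_set X E)) : Prop := {
  soft_topology_null : tau soft_null;
  soft_topology_absolute : tau soft_absolute;
  soft_topology_bigunion :
    forall S : set (soft_set X E), S `<=` tau -> tau (soft_bigunion S);
  soft_topology_inter :
    forall F G : soft_set X E, tau F -> tau G -> tau (soft_inter F G)
}.

Section SemiOperators.
Context {X E : Type} (tau : set (soft_set X E)).
Implicit Types F : soft_set X E.

Definition soft_open F : Prop := tau F.
Definition soft_closed F : Prop := soft_open (soft_compl F).

Definition soft_closure F : soft_set X E :=
  soft_biginter [set G | soft_closed G /\ soft_subset F G].

Definition soft_semi_open F : Prop :=
  exists G : soft_set X E,
    [/\ soft_open G, soft_subset G F & soft_subset F (soft_closure G)].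

Definition soft_semi_interior F : soft_set X E :=
  soft_bigunion [set G | soft_semi_open G /\ soft_subset G F].

Definition soft_semi_exterior F : soft_set X E :=
  soft_semi_interior (soft_compl F).

Definition soft_semi_boundary F : soft_set X E :=
  soft_compl (soft_union (soft_semi_interior F) (soft_semi_exterior F)).

End SemiOperators.

(* Main.v *)
Require Import Defs.
From mathcomp Require Import all_boot.
From mathcomp Require Import boolp classical_sets.

(** Soft semi-open sets are stable under arbitrary unions, although in general
    not under intersections.  Hence the semi-interior of a soft set is its
    largest semi-open soft subset, and every semi-boundary is semi-closed, its
    complement being the union of a semi-interior and a semi-exterior.

    A semi-closed [C] has semi-exterior equal to its complement, so its
    semi-boundary is [C] minus its semi-interior.  That set has null
    semi-interior: a semi-open soft set inside it is a semi-open soft subset of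
    [C], hence lies in the semi-interior of [C], which has just been removed.
    With [C] the semi-boundary of [F], the soft set [B], the semi-boundary of
    [C], is therefore semi-closed with null semi-interior, and removing the
    semi-interior from such a [B] gives [B] back. *)

Local Open Scope classical_set_scope.

Section SemiBoundary.
Set Implicit Arguments.
Unset Strict Implicit.
Context {X E : Type} {tau : set (soft_set X E)}.
Implicit Types F G C : soft_set X E.

Lemma soft_subset_antisym {F G} : soft_subset F G -> soft_subset G F -> F = G.
Proof. by move=> FG GF; apply/funext => e; apply/seteqP; split. Qed.

Lemma soft_complK F : soft_compl (soft_compl F) = F.
Proof. by apply/funext => e; exact: setCK. Qed.

Lemma soft_closure_mono F G :
  soft_subset F G -> soft_subset (soft_closure tau F) (soft_closure tau G).
Proof.
move=> FG e x clFx H [Hcl GH]; apply: (clFx H); split=> // e' y Fy.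
exact/GH/FG.
Qed.

(** The open witness is the union of all open soft sets lying in some member of
    [S], so that no witness has to be chosen for each member. *)
Lemma soft_semi_open_bigunion (tau_top : soft_topology tau)
  (S : set (soft_set X E)) :
  S `<=` soft_semi_open tau -> soft_semi_open tau (soft_bigunion S).
Proof.
move=> S_semi.
pose W := [set G | tau G /\ exists2 F, S F & soft_subset G F].
exists (soft_bigunion W); split.
- by apply: (soft_topology_bigunion tau_top) => G [].
- by move=> e x [G [_ [F SF GF]] Gx]; exists F => //; exact: GF.
- move=> e x [F SF Fx]; have [G [Gop GF FclG]] := S_semi _ SF.
  apply: soft_closure_mono (FclG _ _ Fx) => e' y Gy.
  by exists G => //; split=> //; exists F.
Qed.

Lemma soft_semi_open_union (tau_top : soft_topology tau) F G :
  soft_semi_open tau F -> soft_semi_open tau G ->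
  soft_semi_open tau (soft_union F G).
Proof.
move=> Fso Gso.
suff -> : soft_union F G = soft_bigunion [set F; G].
  by apply: soft_semi_open_bigunion => // H [] ->.
by apply/funext => e; rewrite /soft_bigunion bigcup_setU !bigcup_set1.
Qed.

Lemma soft_semi_interior_semi_open (tau_top : soft_topology tau) F :
  soft_semi_open tau (soft_semi_interior tau F).
Proof. by apply: soft_semi_open_bigunion => // G []. Qed.

Lemma soft_semi_interior_subset F : soft_subset (soft_semi_interior tau F) F.
Proof. by move=> e x [G [_ GF] Gx]; exact: GF. Qed.

Lemma soft_semi_interior_mono F G : soft_subset F G ->
  soft_subset (soft_semi_interior tau F) (soft_semi_interior tau G).
Proof.
move=> FG e x [H [Hso HF] Hx]; exists H => //; split=> // e' y Hy.
exact/FG/HF.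
Qed.

Lemma soft_semi_interior_id F :
  soft_semi_open tau F -> soft_semi_interior tau F = F.
Proof.
move=> Fso; apply: soft_subset_antisym; first exact: soft_semi_interior_subset.
by move=> e x Fx; exists F => //; split=> // e' y.
Qed.

Lemma soft_semi_boundary_semi_closed (tau_top : soft_topology tau) F :
  soft_semi_open tau (soft_compl (soft_semi_boundary tau F)).
Proof.
rewrite soft_complK.
by apply: soft_semi_open_union => //; apply: soft_semi_interior_semi_open.
Qed.

Lemma soft_semi_boundary_of_semi_closed C :
  soft_semi_open tau (soft_compl C) ->
  soft_semi_boundary tau C =
  soft_inter C (soft_compl (soft_semi_interior tau C)).
Proof.
move=> C_closed; rewrite /soft_semi_boundary /soft_semi_exterior.
rewrite (soft_semi_interior_id C_closed); apply/funext => e.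
by rewrite /soft_compl /soft_union /soft_inter setCU setCK setIC.
Qed.

(** A semi-open soft set inside the semi-boundary of [C] is inside [C], hence
    inside the semi-interior of [C], which the semi-boundary avoids. *)
Lemma soft_semi_interior_boundary_null C :
  soft_semi_open tau (soft_compl C) ->
  soft_semi_interior tau (soft_semi_boundary tau C) = soft_null.
Proof.
move=> C_closed; rewrite soft_semi_boundary_of_semi_closed //.
apply: soft_subset_antisym => e x; last by [].
move=> intx.
have [_ nintCx] := soft_semi_interior_subset intx.
by apply: nintCx; apply: soft_semi_interior_mono intx => e' y [].
Qed.

Lemma soft_semi_boundary_id C :
  soft_semi_open tau (soft_compl C) ->
  soft_semi_interior tau C = soft_null -> soft_semi_boundary tau C = C.
Proof.
move=> C_closed intC0; rewrite soft_semi_boundary_of_semi_closed // intC0.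
by apply/funext => e; rewrite /soft_inter /soft_compl setC0 setIT.
Qed.

End SemiBoundary.

Theorem theorem3p18 (X E : Type) (E_nonempty : inhabited E)
  (tau : set (soft_set X E)) (tau_top : soft_topology tau)
  (F : soft_set X E) :
  soft_semi_boundary tau (soft_semi_boundary tau (soft_semi_boundary tau F))
  = soft_semi_boundary tau (soft_semi_boundary tau F).
Proof.
apply: soft_semi_boundary_id; first exact: soft_semi_boundary_semi_closed.
apply: soft_semi_interior_boundary_null.
exact: soft_semi_boundary_semi_closed.
Qed.
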